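(* Let $n\ge 34$ be an even integer and let $D_n=2\lceil n/4\rceil-1$. There exists a graph of order $n$ in which every vertex has degree $D_n$ or $D_n+1$, and whose maximum number of pairwise edge-disjoint perfect matchings is exactly $\lceil n/4\rceil$.
   Context: All graphs are finite, simple, and undirected. *)

(* Defs.v *)
From mathcomp Require Import all_boot.
Set Implicit Arguments.
Unset Strict Implicit.
Unset Printing Implicit Defensive.

Record sgraph := SGraph {
  vertex :> finType;
  adj : rel vertex;
  adj_sym : symmetric adj;
  adj_irr : irreflexive adj
}.

Definition degree (G : sgraph) (v : G) : nat := #|[set w : G | adj v w]|.

Definition edges (G : sgraph) : {set {set G}} :=
  [set [set x; y] | x in G, y in G & adj x y].

Definition perfect_matching (G : sgraph) (M : {set {set G}}) : bool :=
  [&& M \subset edges G, trivIset M & cover M == [set: G]].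

(* Members of [F] are distinct sets of edges, and [trivIset F] makes them
   pairwise disjoint as such. *)
Definition disjoint_perfect_matchings (G : sgraph)
    (F : {set {set {set G}}}) : bool :=
  [forall M in F, perfect_matching M] && trivIset F.

Definition max_disjoint_perfect_matchings (G : sgraph) : nat :=
  \max_(F : {set {set {set G}}} | disjoint_perfect_matchings F) #|F|.

Definition ceil_div (m d : nat) : nat := (m + d.-1) %/ d.

Definition D (n : nat) : nat := 2 * ceil_div n 4 - 1.

(* Main.v *)
(** Let [n = 2 m + 2] and [k = ceil (n / 4)], so that [m] is [2 k - 2] or
    [2 k - 1].  The vertices split into a set [A] of size [m + 2] and an
    independent set [B] of size [m].  The edges inside [A] are the [k] pairs
    [{a_(2j), a_(2j+1)}]; between [A] and [B] all edges are present, except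
    that the edges [a_i b_i] are removed when [m] is odd.  As [A] is larger
    than [B], every perfect matching uses an edge inside [A], so at most [k]
    of them are pairwise disjoint.  Conversely, for [j < k] there is a perfect
    matching containing [{a_(2j), a_(2j+1)}] which sends the other [a_i],
    [i < m], to [b_(i + k - j)], indices being taken modulo [m]; it leaves
    [b_(k + j)] and [b_(k + j + 1)] to [a_(m+1)] and [a_m] respectively.  The
    shifts [k - j] are distinct and nonzero modulo [m], and so these [k]
    matchings are disjoint and avoid the edges [a_i b_i]. *)

Require Import Defs.
From mathcomp Require Import all_boot.
From mathcomp Require Import zify.

Set Implicit Arguments.
Unset Strict Implicit.
Unset Printing Implicit Defensive.

Lemma set2_injr (T : finType) (x y z : T) :
  y != x -> [set x; y] = [set x; z] -> y = z.
Proof.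
move=> yx eq_xyz; have: y \in [set x; z] by rewrite -eq_xyz set22.
by rewrite !inE (negPf yx) => /eqP.
Qed.

Lemma adj_neq (G : sgraph) (x y : G) : adj x y -> y != x.
Proof. by apply: contraTneq => ->; rewrite adj_irr. Qed.

Lemma edgesP (G : sgraph) (e : {set G}) :
  reflect (exists x y : G, adj x y /\ e = [set x; y]) (e \in edges G).
Proof.
apply: (iffP imset2P) => [[x y _] | [x [y [xy ->]]]].
  by rewrite inE => /andP[_ xy] ->; exists x, y.
by exists x y => //; rewrite inE /= xy.
Qed.

(** * Disjoint perfect matchings from fixed-point-free involutions *)

Section MatchingOfInvolution.
Variables (G : sgraph) (f : G -> G).
Hypotheses (fK : involutive f) (f_adj : forall v, adj v (f v)).

Definition involution_matching : {set {set G}} := [set [set v; f v] | v in G].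

Lemma involution_matching_edge e v :
  e \in involution_matching -> v \in e -> e = [set v; f v].
Proof.
case/imsetP=> u _ ->; rewrite !inE => /orP[]/eqP-> //.
by rewrite fK setUC.
Qed.

Lemma involution_matching_perfect : perfect_matching involution_matching.
Proof.
apply/and3P; split.
- by apply/subsetP=> _ /imsetP[v _ ->]; apply/edgesP; exists v, (f v).
- apply/trivIsetP=> e1 e2 Me1 Me2; apply: contraNT => /pred0Pn[v /andP[/= v1 v2]].
  by rewrite (involution_matching_edge Me1 v1) (involution_matching_edge Me2 v2).
- rewrite -subTset; apply/subsetP=> v _; apply/bigcupP.
  by exists [set v; f v]; [apply: imset_f | rewrite set21].
Qed.

End MatchingOfInvolution.

(** An edge through [v] shared by two of the matchings is both [{v, f i v}] and [{v, f j v}],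
    forcing [i = j]. The vertex [v0] makes the matchings nonempty, hence distinct. *)
Lemma leq_max_disjoint_perfect_matchings (G : sgraph) (v0 : G) (k : nat)
    (f : 'I_k -> G -> G) :
  (forall j, involutive (f j)) -> (forall j v, adj v (f j v)) ->
  (forall v, injective (f^~ v)) -> k <= max_disjoint_perfect_matchings G.
Proof.
move=> fK f_adj f_inj; pose M j := involution_matching (f j).
have common i j e : e \in M i -> e \in M j -> i = j.
  move=> Mie Mje; have /imsetP[v _ def_e] := Mie.
  have ve : v \in e by rewrite def_e set21.
  move: Mje => /(involution_matching_edge (fK j))/(_ ve); rewrite def_e.
  by move/(set2_injr (adj_neq (f_adj i v)))/f_inj.
have M_inj : injective M.
  move=> i j eqM; have Mi0 : [set v0; f i v0] \in M i by apply: imset_f.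
  by apply: (common i j _ Mi0); rewrite -eqM.
have <- : #|[set M j | j in 'I_k]| = k by rewrite card_imset ?card_ord.
apply: leq_bigmax_cond; apply/andP; split.
  apply/forall_inP=> _ /imsetP[j _ ->].
  exact: involution_matching_perfect.
apply/trivIsetP=> _ _ /imsetP[i _ ->] /imsetP[j _ ->]; apply: contraNT.
by case/pred0Pn=> e /andP[/= Mi Mj]; rewrite (common i j e Mi Mj).
Qed.

(** * Upper bound by the edges inside a majority part *)

Lemma perfect_matching_inner_edge (G : sgraph) (A : {set G}) (M : {set {set G}}) :
  (forall x y : G, adj x y -> (x \in A) || (y \in A)) -> #|~: A| < #|A| ->
  perfect_matching M -> exists2 e, e \in M & e \subset A.
Proof.
move=> indep ltBA /and3P[sME tiM /eqP covM].
apply/exists_inP; apply: contraTT ltBA => /exists_inPn outM; rewrite -leqNgt.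
(* [M] partitions the vertices. Were no edge of [M] inside [A], each would meet [A] in no more
   vertices than [~: A]. *)
have card_cover (S : {set G}) : #|S| = \sum_(e in M) \sum_(x in e) (x \in S).
  rewrite -big_trivIset //= covM -sum1_card big_mkcond /=.
  by apply: eq_big => x; rewrite ?inE //; case: (x \in S).
rewrite (card_cover A) (card_cover (~: A)); apply: leq_sum => e Me.
have /edgesP[x [y [xy def_e]]] := subsetP sME _ Me.
have := outM e Me; rewrite def_e subUset !sub1set.
have xNy : x \notin [set y] by rewrite inE eq_sym (adj_neq xy).
rewrite !big_setU1 //= !big_set1 !inE.
by have := indep _ _ xy; case: (x \in A); case: (y \in A).
Qed.

Lemma max_disjoint_perfect_matchings_leq (G : sgraph) (A : {set G}) :
  (forall x y : G, adj x y -> (x \in A) || (y \in A)) -> #|~: A| < #|A| ->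
  max_disjoint_perfect_matchings G <= #|[set e in edges G | e \subset A]|.
Proof.
move=> indep ltBA; apply/bigmax_leqP=> F /andP[/forall_inP pmF /trivIsetP tiF].
(* The default [set0] is never reached on [F]. Disjointness makes [phi] injective there. *)
pose phi (M : {set {set G}}) := odflt set0 [pick e in M | e \subset A].
have phiP M : M \in F -> (phi M \in M) && (phi M \subset A).
  move=> FM; rewrite /phi; case: pickP => [e //| /= noe].
  have [e Me sAe] := perfect_matching_inner_edge indep ltBA (pmF _ FM).
  by have := noe e; rewrite Me sAe.
rewrite -(card_in_imset (f := phi)) => [|M N FM FN eq_phi].
  apply/subset_leq_card/subsetP=> _ /imsetP[M FM ->]; have /andP[phiM sA] := phiP _ FM.
  have /and3P[sME _ _] := pmF _ FM.
  by rewrite inE sA (subsetP sME).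
have [//|neqMN] := eqVneq M N; have /pred0P/(_ (phi M)) := tiF _ _ FM FN neqMN.
have /andP[phiM _] := phiP _ FM; have /andP[phiN _] := phiP _ FN.
by rewrite /= phiM eq_phi phiN.
Qed.

Lemma card_ord_count n (P : pred nat) : #|[set i : 'I_n | P i]| = count P (iota 0 n).
Proof.
rewrite cardsE cardE size_filter -val_enum_ord count_map enumT.
exact: eq_count.
Qed.

Lemma count_iota_pred1 a l x : count (pred1 x) (iota a l) = (a <= x < a + l).
Proof. by rewrite count_uniq_mem ?iota_uniq // mem_iota. Qed.

Lemma count_iota_predC1 a l x :
  count (predC1 x) (iota a l) = l - (a <= x < a + l).
Proof.
rewrite -[LHS](addKn (count (pred1 x) (iota a l))) count_predC size_iota.
by rewrite count_iota_pred1.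
Qed.

(** * The graph, its degrees and its inner edges *)

Section Construction.
Variable m : nat.
Let k := m.+2./2.

(* Vertices are coded as numbers below [2 m + 2]: [a_i] is [i], for
   [i < m + 2], and [b_i] is [m + 2 + i]. *)

Definition half_adj (u v : nat) : bool :=
  (u < m.+2) &&
  (if v < m.+2 then (u != v) && (u./2 == v./2)
   else ~~ odd m || (v != m.+2 + u)).

Definition vertex_adj : rel 'I_(2 * m.+1) :=
  fun u v => half_adj u v || half_adj v u.

Lemma vertex_adj_sym : symmetric vertex_adj.
Proof. by move=> u v; rewrite /vertex_adj orbC. Qed.

Lemma vertex_adj_irr : irreflexive vertex_adj.
Proof. by move=> u; rewrite /vertex_adj orbb /half_adj; case: ltnP; rewrite ?eqxx. Qed.

Definition pairing_graph : sgraph := SGraph vertex_adj_sym vertex_adj_irr.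

Lemma pairing_graph_degree (v : pairing_graph) :
  degree v = k.*2.-1 \/ degree v = k.*2.
Proof.
have vn : v < 2 * m.+1 := ltn_ord v.
rewrite /degree (card_ord_count _ (fun w => half_adj v w || half_adj w v)).
move: (nat_of_ord v) vn => {}v vn.
have -> : 2 * m.+1 = m.+2 + m by lia.
rewrite iotaD count_cat add0n.
have [vA | vB] := ltnP v m.+2.
  have -> : count (fun w => half_adj v w || half_adj w v) (iota 0 m.+2)
      = (v < k.*2).
    (* [w] is the mate of [v]. For odd [m] the mate of [m.+1] is [m.+2], outside [A], so [a_(m+1)]
       is unpaired. *)
    pose w := if odd v then v.-1 else v.+1.
    transitivity (count (pred1 w) (iota 0 m.+2)).
      apply: eq_in_count => u; rewrite mem_iota /half_adj /w /=.
      by do !case: ifP; lia.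
    by rewrite count_iota_pred1 /w /k; case: ifP; lia.
  have -> : count (fun w => half_adj v w || half_adj w v) (iota m.+2 m)
      = m - (odd m && (v < m)).
    have [om | em] := boolP (odd m).
      transitivity (count (predC1 (m.+2 + v)) (iota m.+2 m)).
        by apply: eq_in_count => u; rewrite mem_iota /half_adj /=; do !case: ifP; lia.
      by rewrite count_iota_predC1; lia.
    rewrite subn0 -[RHS](size_iota m.+2 m); apply/eqP; rewrite -all_count.
    by apply/allP => u; rewrite mem_iota /half_adj; do !case: ifP; lia.
  by rewrite /k; lia.
have -> : count (fun w => half_adj v w || half_adj w v) (iota m.+2 m) = 0.
  rewrite -(count_pred0 (iota m.+2 m)); apply: eq_in_count => u.
  by rewrite mem_iota /half_adj /=; do !case: ifP; lia.
have -> : count (fun w => half_adj v w || half_adj w v) (iota 0 m.+2)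
    = m.+2 - odd m.
  have [om | em] := boolP (odd m).
    transitivity (count (predC1 (v - m.+2)) (iota 0 m.+2)).
      by apply: eq_in_count => u; rewrite mem_iota /half_adj /=; do !case: ifP; lia.
    by rewrite count_iota_predC1; lia.
  rewrite subn0 -[RHS](size_iota 0 m.+2); apply/eqP; rewrite -all_count.
  by apply/allP => u; rewrite mem_iota /half_adj; do !case: ifP; lia.
by lia.
Qed.

Lemma pairing_graph_max_leq : max_disjoint_perfect_matchings pairing_graph <= k.
Proof.
pose A : {set pairing_graph} := [set i : 'I_(2 * m.+1) | i < m.+2].
have cardA : #|A| = m.+2.
  rewrite /A (card_ord_count _ (fun i => i < m.+2)).
  have -> : 2 * m.+1 = m.+2 + m by lia.
  rewrite iotaD count_cat add0n.
  have -> : count (fun i => i < m.+2) (iota 0 m.+2) = m.+2.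
    rewrite -[RHS](size_iota 0 m.+2); apply/eqP; rewrite -all_count.
    by apply/allP => i; rewrite mem_iota.
  have -> : count (fun i => i < m.+2) (iota m.+2 m) = 0; last by rewrite addn0.
  rewrite -(count_pred0 (iota m.+2 m)); apply: eq_in_count => i.
  by rewrite mem_iota /=; lia.
have cardG : #|pairing_graph| = 2 * m.+1 := card_ord _.
apply: leq_trans (@max_disjoint_perfect_matchings_leq _ A _ _) _.
- by move=> x y; rewrite !inE /= /vertex_adj /half_adj; do !case: ifP; lia.
- by have := cardsC A; rewrite cardA cardG; lia.
pose pair (j : 'I_k) : {set pairing_graph} := [set inord j.*2; inord j.*2.+1].
rewrite -[leqRHS]card_ord; apply: leq_trans (leq_imset_card pair _).
apply/subset_leq_card/subsetP=> e; rewrite inE => /andP[/edgesP[x [y [xy ->]]]].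
rewrite subUset !sub1set !inE => /andP[xA yA].
have [xNy xy2] : x != y :> nat /\ x./2 = y./2.
  by move: xy; rewrite /= /vertex_adj /half_adj xA yA; lia.
(* Only [x = m.+1] with [m] odd has half equal to [k], and it has no mate [y] in [A]. *)
have jk : x./2 < k by rewrite /k; lia.
apply/imsetP; exists (Ordinal jk) => //.
have ordE (i : nat) (z : 'I_(2 * m.+1)) : i = z -> inord i = z.
  by move=> ->; rewrite inord_val.
rewrite /pair /=; have [ox | ex] := boolP (odd x).
  by rewrite setUC; congr [set _; _]; apply/esym/ordE; lia.
by congr [set _; _]; apply/esym/ordE; lia.
Qed.

(** * The [k] disjoint perfect matchings *)

Hypothesis k_ge2 : 1 < k.

(** Reduction modulo [m] for arguments below [2 * m], kept within linear arithmetic. *)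
Definition wrap (i : nat) : nat := if i < m then i else i - m.

(** The last branch undoes the shift, redirecting the two vertices of [B] that would meet the pair.
    For [j = k - 1] the pair contains [a_m], and also [a_(m+1)] if [m] is even, so the tests for the
    pair must come first. *)
Definition partner (j v : nat) : nat :=
  if v == j.*2 then j.*2.+1
  else if v == j.*2.+1 then j.*2
  else if v < m then m.+2 + wrap (v + (k - j))
  else if v == m then m.+2 + wrap (k + j.+1)
  else if v == m.+1 then m.+2 + wrap (k + j)
  else let i := wrap (v - m.+2 + (m - (k - j))) in
       if i == j.*2 then m.+1 else if i == j.*2.+1 then m else i.

Lemma partner_lt j v : j < k -> v < 2 * m.+1 -> partner j v < 2 * m.+1.
Proof. by rewrite /partner /wrap /k; do !case: ifP; lia. Qed.

Lemma partnerK j v : j < k -> v < 2 * m.+1 -> partner j (partner j v) = v.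
Proof.
move=> jk vn; move def_w: (partner j v) => w; move: def_w.
rewrite /partner /wrap; move: k_ge2 jk; rewrite /k.
by do !case: ifP; lia.
Qed.

Lemma partner_adj j v : j < k -> v < 2 * m.+1 ->
  half_adj v (partner j v) || half_adj (partner j v) v.
Proof.
move=> jk vn; move def_w: (partner j v) => w; move: def_w.
rewrite /half_adj /partner /wrap; move: k_ge2 jk; rewrite /k.
by do !case: ifP; lia.
Qed.

(** From [1 < k] follows [k <= m], so for [j < k] the values [k - j] are distinct modulo [m], as are
    the [k + j]. *)
Lemma partner_inj i j v : i < k -> j < k -> v < 2 * m.+1 ->
  partner i v = partner j v -> i = j.
Proof.
rewrite /partner /wrap; move: k_ge2; rewrite /k.
by do !case: ifP; lia.
Qed.

Lemma pairing_graph_leq_max : k <= max_disjoint_perfect_matchings pairing_graph.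
Proof.
pose f (j : 'I_k) (v : pairing_graph) : pairing_graph :=
  Ordinal (partner_lt (ltn_ord j) (ltn_ord v)).
apply: (@leq_max_disjoint_perfect_matchings pairing_graph ord0 k f).
- by move=> j v; apply: val_inj; apply: partnerK.
- by move=> j v; apply: partner_adj.
- by move=> v i j /(congr1 val) /partner_inj eq_ij; apply: val_inj; apply: eq_ij.
Qed.

End Construction.

Theorem theorem3p4 (n : nat) (hn : 34 <= n) (heven : ~~ odd n) :
  exists G : sgraph,
    [/\ #|G| = n,
        forall v : G, degree v = D n \/ degree v = D n + 1
      & max_disjoint_perfect_matchings G = ceil_div n 4].
Proof.
pose m := n./2.-1.
have def_n : n = 2 * m.+1 by rewrite /m; lia.
(* Here [n / 4] is [(m + 1) / 2], whose ceiling is the floor of [(m + 2) / 2]. *)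
have def_k : ceil_div n 4 = m.+2./2 by rewrite /ceil_div def_n; lia.
have k_ge2 : 1 < m.+2./2 by rewrite /m; lia.
exists (pairing_graph m); split.
- by rewrite card_ord.
- by move=> v; have := pairing_graph_degree v; rewrite /D def_k; lia.
- apply/eqP; rewrite def_k eqn_leq pairing_graph_max_leq.
  exact: pairing_graph_leq_max.
Qed.
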